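(* For all processes $P,Q\in\mathcal P$: $P\sqsupseteq_{1\text{-nv}}Q$ if and only if $P\sqsupseteq_{2\text{-nv}}Q$. That is, the 1-naive and the 2-naive faster-than preorders coincide.
   Context: TACS. Fix a countable set $\Lambda$ of action names; $\overline{\Lambda}=\{\overline a : a\in\Lambda\}$ with $\overline{\overline a}=a$; $\mathcal A=\Lambda\cup\overline\Lambda\cup\{\tau\}$ is the set of actions (ranged over by $\alpha$), and $a$ ranges over $\Lambda\cup\overline\Lambda$. Terms (set $\widehat{\mathcal P}$) are generated by $P::=\mathbf 0\mid x\mid \alpha.P\mid \sigma.P\mid P+P\mid P|P\mid P\backslash L\mid P[f]\mid \mu x.P$, where $x$ ranges over a countably infinite set of variables, $L\subseteq\mathcal A\setminus\{\tau\}$ is finite, and $f:\mathcal A\to\mathcal A$ satisfies $f(\tau)=\tau$, $f(\overline a)=\overline{f(a)}$ and $f(\alpha)\neq\alpha$ for only finitely many $\alpha$. $\mu x$ binds $x$; $P[Q/x]$ denotes substitution of $Q$ for the free occurrences of $x$. A variable is guarded in a term if each of its occurrences is in the scope of an action prefix $\alpha.\_$ (a $\sigma$-prefix does not count). In every term $\mu x.P$, $x$ must be guarded in $P$. Processes (set $\mathcal P$) are the closed terms; $\equiv$ is syntactic equality. $\overline L=\{\overline a: a\in L\}$. Urgent sets: $\mathcal U(\sigma.P)=\mathcal U(\mathbf 0)=\mathcal U(x)=\emptyset$, $\mathcal U(\alpha.P)=\{\alpha\}$, $\mathcal U(P+Q)=\mathcal U(P)\cup\mathcal U(Q)$, $\mathcal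 U(P|Q)=\mathcal U(P)\cup\mathcal U(Q)\cup\{\tau\mid \mathcal U(P)\cap\overline{\mathcal U(Q)}\neq\emptyset\}$, $\mathcal U(P\backslash L)=\mathcal U(P)\setminus(L\cup\overline L)$, $\mathcal U(P[f])=\{f(\alpha):\alpha\in\mathcal U(P)\}$, $\mathcal U(\mu x.P)=\mathcal U(P)$. Action transitions $\xrightarrow{\alpha}$ are the least relations with: $\alpha.P\xrightarrow{\alpha}P$; if $P\xrightarrow{\alpha}P'$ then $\sigma.P\xrightarrow{\alpha}P'$, $\mu x.P\xrightarrow{\alpha}P'[\mu x.P/x]$, $P+Q\xrightarrow{\alpha}P'$, $Q+P\xrightarrow{\alpha}P'$, $P|Q\xrightarrow{\alpha}P'|Q$, $Q|P\xrightarrow{\alpha}Q|P'$, $P[f]\xrightarrow{f(\alpha)}P'[f]$, and $P\backslash L\xrightarrow{\alpha}P'\backslash L$ if $\alpha\notin L\cup\overline L$; if $P\xrightarrow{a}P'$ and $Q\xrightarrow{\overline a}Q'$ then $P|Q\xrightarrow{\tau}P'|Q'$. Clock transitions $\xrightarrow{\sigma}_i$ ($i\in\{1,2\}$) are the least relations with: $\mathbf 0\xrightarrow{\sigma}_i\mathbf 0$; $a.P\xrightarrow{\sigma}_i a.P$ for $a\in\Lambda\cup\overline\Lambda$; $\sigma.P\xrightarrow{\sigma}_iP$; if $P\xrightarrow{\sigma}_iP'$ then $\mu x.P\xrightarrow{\sigma}_iP'[\mu x.P/x]$, $P\backslash L\xrightarrow{\sigma}_iP'\backslash L$, $P[f]\xrightarrow{\sigma}_iP'[f]$;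 if $P\xrightarrow{\sigma}_iP'$ and $Q\xrightarrow{\sigma}_iQ'$ then $P+Q\xrightarrow{\sigma}_iP'+Q'$, and $P|Q\xrightarrow{\sigma}_iP'|Q'$ provided $\tau\notin\mathcal U(P|Q)$; and, only for $i=2$: if $P\xrightarrow{\sigma}_2P'$ then $\sigma.P\xrightarrow{\sigma}_2P'$. For $i\in\{1,2\}$, a relation $\mathcal R\subseteq\mathcal P\times\mathcal P$ is an i-naive faster-than relation if for all $(P,Q)\in\mathcal R$ and $\alpha\in\mathcal A$: (1) $P\xrightarrow{\alpha}P'$ implies $Q\xrightarrow{\alpha}Q'$ for some $Q'$ with $(P',Q')\in\mathcal R$; (2) $Q\xrightarrow{\alpha}Q'$ implies $P\xrightarrow{\alpha}P'$ for some $P'$ with $(P',Q')\in\mathcal R$; (3) $P\xrightarrow{\sigma}_iP'$ implies $Q\xrightarrow{\sigma}_iQ'$ for some $Q'$ with $(P',Q')\in\mathcal R$. $P\sqsupseteq_{i\text{-nv}}Q$ iff $(P,Q)$ belongs to some i-naive faster-than relation. *)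

(* Defs.v *)
From mathcomp Require Import all_boot finmap.

Set Implicit Arguments.
Unset Strict Implicit.
Unset Printing Implicit Defensive.

(* Visible actions: (a, false) is the name a, (a, true) its complement. *)
Notation visible Λ := (Λ * bool)%type.

Definition bar (Λ : countType) (a : visible Λ) : visible Λ := (a.1, ~~ a.2).

(* Actions: None is τ, Some a is the visible action a. *)
Notation action Λ := (option (visible Λ)).
Notation tau := None (only parsing).

(* Complementation is not defined on τ, so f(ā) = \overline{f(a)} presupposes
   that f(a) is visible; this is what [relabel_bar] says. *)
Record relabelling (Λ : countType) := Relabelling {
  relabel :> action Λ -> action Λ;
  relabel_tau : relabel tau = tau;
  relabel_bar : forall a : visible Λ,
    exists2 b : visible Λ, relabel (Some a) = Some b
                         & relabel (Some (bar a)) = Some (bar b);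
  relabel_finite : exists s : seq (action Λ),
    forall α : action Λ, relabel α <> α -> α \in s }.

(* Terms in de Bruijn notation: [Mu P] binds index 0 of P, so that terms are
   represented up to renaming of bound variables.  The guardedness requirement
   on recursion is imposed separately by [wf]. *)
Inductive term (Λ : countType) : Type :=
| Nil
| Var of nat
| Act of action Λ & term Λ
| Clock of term Λ
| Sum of term Λ & term Λ
| Par of term Λ & term Λ
| Res of term Λ & {fset visible Λ}
| Rel of term Λ & relabelling Λ
| Mu of term Λ.

Arguments Nil {Λ}.
Arguments Var {Λ} _.

(* Increments all free indices >= k. *)
Fixpoint shift (Λ : countType) (k : nat) (P : term Λ) : term Λ :=
  match P with
  | Nil => Nil
  | Var n => Var (if n < k then n else n.+1)
  | Act α P1 => Act α (shift k P1)
  | Clock P1 => Clock (shift k P1)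
  | Sum P1 P2 => Sum (shift k P1) (shift k P2)
  | Par P1 P2 => Par (shift k P1) (shift k P2)
  | Res P1 L => Res (shift k P1) L
  | Rel P1 f => Rel (shift k P1) f
  | Mu P1 => Mu (shift k.+1 P1)
  end.

(* Capture-avoiding substitution of Q for the free index k, which disappears:
   larger free indices are decremented. *)
Fixpoint subst (Λ : countType) (k : nat) (Q P : term Λ) : term Λ :=
  match P with
  | Nil => Nil
  | Var n => if n == k then Q else Var (if n < k then n else n.-1)
  | Act α P1 => Act α (subst k Q P1)
  | Clock P1 => Clock (subst k Q P1)
  | Sum P1 P2 => Sum (subst k Q P1) (subst k Q P2)
  | Par P1 P2 => Par (subst k Q P1) (subst k Q P2)
  | Res P1 L => Res (subst k Q P1) L
  | Rel P1 f => Rel (subst k Q P1) f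
  | Mu P1 => Mu (subst k.+1 (shift 0 Q) P1)
  end.

Fixpoint guarded (Λ : countType) (k : nat) (P : term Λ) : bool :=
  match P with
  | Nil => true
  | Var n => n != k
  | Act _ _ => true
  | Clock P1 => guarded k P1
  | Sum P1 P2 | Par P1 P2 => guarded k P1 && guarded k P2
  | Res P1 _ => guarded k P1
  | Rel P1 _ => guarded k P1
  | Mu P1 => guarded k.+1 P1
  end.

Fixpoint wf (Λ : countType) (P : term Λ) : bool :=
  match P with
  | Nil | Var _ => true
  | Act _ P1 | Clock P1 | Res P1 _ | Rel P1 _ => wf P1
  | Sum P1 P2 | Par P1 P2 => wf P1 && wf P2
  | Mu P1 => guarded 0 P1 && wf P1
  end.

(* All free indices of P are < k. *)
Fixpoint closed_at (Λ : countType) (k : nat) (P : term Λ) : bool :=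
  match P with
  | Nil => true
  | Var n => n < k
  | Act _ P1 | Clock P1 | Res P1 _ | Rel P1 _ => closed_at k P1
  | Sum P1 P2 | Par P1 P2 => closed_at k P1 && closed_at k P2
  | Mu P1 => closed_at k.+1 P1
  end.

Definition process (Λ : countType) (P : term Λ) : bool :=
  wf P && closed_at 0 P.

(* α \in L ∪ \overline{L} *)
Definition restricted (Λ : countType) (L : {fset visible Λ}) (α : action Λ)
  : bool :=
  if α is Some a then (a \in L) || (bar a \in L) else false.

(* [urgent P] is the set U(P).  In the parallel case a common element of U(P)
   and \overline{U(Q)} is taken to be visible; if τ is in U(P) or U(Q), it is
   in the union anyway. *)
Fixpoint urgent (Λ : countType) (P : term Λ) (α : action Λ) : Prop :=
  match P with
  | Nil | Var _ | Clock _ => False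
  | Act β _ => α = β
  | Sum P1 P2 => urgent P1 α \/ urgent P2 α
  | Par P1 P2 =>
      [\/ urgent P1 α, urgent P2 α
        | α = tau /\ exists2 a : visible Λ,
            urgent P1 (Some a) & urgent P2 (Some (bar a))]
  | Res P1 L => urgent P1 α /\ ~~ restricted L α
  | Rel P1 f => exists2 β : action Λ, urgent P1 β & α = f β
  | Mu P1 => urgent P1 α
  end.

Inductive step (Λ : countType) : term Λ -> action Λ -> term Λ -> Prop :=
| step_act α P : step (Act α P) α P
| step_clock α P P' : step P α P' -> step (Clock P) α P'
| step_mu α P P' : step P α P' -> step (Mu P) α (subst 0 (Mu P) P')
| step_suml α P P' Q : step P α P' -> step (Sum P Q) α P'
| step_sumr α P P' Q : step P α P' -> step (Sum Q P) α P'
| step_parl α P P' Q : step P α P' -> step (Par P Q) α (Par P' Q)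
| step_parr α P P' Q : step P α P' -> step (Par Q P) α (Par Q P')
| step_rel α P P' (f : relabelling Λ) :
    step P α P' -> step (Rel P f) (f α) (Rel P' f)
| step_res α P P' L :
    step P α P' -> ~~ restricted L α -> step (Res P L) α (Res P' L)
| step_com a P P' Q Q' :
    step P (Some a) P' -> step Q (Some (bar a)) Q' ->
    step (Par P Q) tau (Par P' Q').

(* The index i of the clock transition relations. *)
Variant version := V1 | V2.

Inductive tick (Λ : countType) (i : version) : term Λ -> term Λ -> Prop :=
| tick_nil : tick i Nil Nil
| tick_act a P : tick i (Act (Some a) P) (Act (Some a) P)
| tick_clock P : tick i (Clock P) P
| tick_mu P P' : tick i P P' -> tick i (Mu P) (subst 0 (Mu P) P')
| tick_res P P' L : tick i P P' -> tick i (Res P L) (Res P' L)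
| tick_rel P P' f : tick i P P' -> tick i (Rel P f) (Rel P' f)
| tick_sum P P' Q Q' :
    tick i P P' -> tick i Q Q' -> tick i (Sum P Q) (Sum P' Q')
| tick_par P P' Q Q' :
    tick i P P' -> tick i Q Q' -> ~ urgent (Par P Q) tau ->
    tick i (Par P Q) (Par P' Q')
| tick_clock2 P P' : i = V2 -> tick i P P' -> tick i (Clock P) P'.

Definition naive_faster_than (Λ : countType) (i : version)
    (R : term Λ -> term Λ -> Prop) : Prop :=
  (forall P Q, R P Q -> process P /\ process Q) /\
  forall P Q, R P Q ->
    [/\ forall α P', step P α P' -> exists2 Q', step Q α Q' & R P' Q',
        forall α Q', step Q α Q' -> exists2 P', step P α P' & R P' Q'
      & forall P', tick i P P' -> exists2 Q', tick i Q Q' & R P' Q'].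

Definition naive_preorder (Λ : countType) (i : version) (P Q : term Λ) : Prop :=
  exists2 R : term Λ -> term Λ -> Prop, naive_faster_than i R & R P Q.

(* Main.v *)
Require Import Defs.
From mathcomp Require Import all_boot finmap zify.

(** Let [faster P Q] mean that [P] arises from [Q] by dropping some clock
    prefixes that are not under an action prefix, possibly after unfolding
    recursions.  Actions see through clock prefixes, so [faster] is a
    bisimulation for actions, and it is a simulation for clock steps because
    [P -σ-> P'] always gives [faster P' P].  The only difference between the two
    clock semantics is that the second may strip several clock prefixes at once:
    [P -σ->_2 P'] implies [P -σ->_1 P1] for some [P1] with [faster P' P1].
    Hence composing a 1-naive relation with [faster] on the left yields a
    2-naive one, and composing a 2-naive relation with [faster] on the right
    yields a 1-naive one. *)

Set Implicit Arguments.
Unset Strict Implicit.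
Unset Printing Implicit Defensive.

Local Notation hyp := ltac:(eassumption) (only parsing).

Section Terms.
Variable Λ : countType.
Implicit Types (P Q S T M : term Λ) (α : action Λ).

(** * De Bruijn calculus of shifting and substitution *)

Lemma shift_shift P i k :
  i <= k -> shift k.+1 (shift i P) = shift i (shift k P).
Proof.
elim: P i k => //= [n|α P IH|P IH|P IHP Q IHQ|P IHP Q IHQ|P IH L|P IH f|P IH] i k le_ik;
  rewrite 1?IH 1?IHP 1?IHQ //.
by congr Var; do !case: ifP; lia.
Qed.

Lemma subst_shift P T k : subst k T (shift k P) = P.
Proof.
elim: P T k => //= [n|α P IH|P IH|P IHP Q IHQ|P IHP Q IHQ|P IH L|P IH f|P IH] T k;
  rewrite 1?IH 1?IHP 1?IHQ //.
case: eqP => [|_]; first by case: ifP; lia.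
by congr Var; do !case: ifP; lia.
Qed.

Lemma shift_subst T S i j :
  i <= j -> shift i (subst j S T) = subst j.+1 (shift i S) (shift i T).
Proof.
elim: T S i j => //= [n|α P IH|P IH|P IHP Q IHQ|P IHP Q IHQ|P IH L|P IH f|P IH] S i j le_ij;
  rewrite 1?IH 1?IHP 1?IHQ ?shift_shift //.
case: eqP => [->|neq_nj].
  by rewrite ltnNge le_ij /= eqxx.
case: eqP => [|_] /=; first by case: ifP; lia.
by congr Var; do !case: ifP; lia.
Qed.

(** The substitution lemma: it lets the unfolding [subst 0 (Mu P) _] commute with an outer
    substitution in the recursion cases below. *)
Lemma subst_subst P S T k j :
  k <= j ->
  subst j S (subst k T P) = subst k (subst j S T) (subst j.+1 (shift k S) P).
Proof.
elim: P S T k j => //= [n|α P IH|P IH|P IHP Q IHQ|P IHP Q IHQ|P IH L|P IH f|P IH] S T k j le_kj;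
  rewrite 1?IH 1?IHP 1?IHQ ?shift_subst ?shift_shift //.
case: (n =P k) => [->|neq_nk].
  by rewrite ifN ?ltnS ?le_kj /= ?eqxx //; apply/eqP; lia.
(* On the right the variable [j.+1] becomes [shift k S], and substituting for the fresh index [k]
   undoes the shift. *)
case: (n =P j.+1) => [->|neq_nj] /=.
  have -> : (j.+1 < k) = false by lia.
  by rewrite eqxx subst_shift.
case: eqP => [|_]; first by case: ifP; lia.
case: eqP => [|_]; first by case: ifP; lia.
by congr Var; do !case: ifP; lia.
Qed.

(** * Guardedness, well-formedness and closedness under substitution *)

Lemma guarded_shift_same P k : guarded k (shift k P).
Proof.
elim: P k => //= [n|P IHP Q IHQ|P IHP Q IHQ] k; rewrite ?IHP ?IHQ //.
by apply/eqP; case: ifP; lia.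
Qed.

(** [bump j k] is the index that [shift j] gives to the variable [k]. *)
Lemma guarded_shift P j k : guarded (bump j k) (shift j P) = guarded k P.
Proof.
elim: P j k => //= [n|P IHP Q IHQ|P IHP Q IHQ|P IH] j k;
  rewrite ?IHP ?IHQ -?bumpS ?IH //.
by rewrite /bump; case: (ltnP n j); case: leqP; lia.
Qed.

(** [bump k j] is the index in [P] of the variable that becomes [j] once [k] has disappeared. *)
Lemma guarded_subst P S j k :
  guarded (bump k j) P -> guarded j S -> guarded j (subst k S P).
Proof.
elim: P S j k => //= [n|P IHP Q IHQ|P IHP Q IHQ|P IH] S j k gP gS.
- case: eqP => // neq_nk /=.
  by move: gP; rewrite /bump; case: ifP; case: leqP; lia.
- by case/andP: gP => gP gQ; rewrite IHP ?IHQ.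
- by case/andP: gP => gP gQ; rewrite IHP ?IHQ.
- apply: IH; first by rewrite bumpS.
  by rewrite -[j.+1]/(bump 0 j) guarded_shift.
Qed.

Lemma wf_shift P k : wf P -> wf (shift k P).
Proof.
elim: P k => //= [P IHP Q IHQ|P IHP Q IHQ|P IH] k /andP[].
- by move=> /IHP-> /IHQ->.
- by move=> /IHP-> /IHQ->.
- by move=> gP /IH->; rewrite -[0]/(bump k.+1 0) guarded_shift gP.
Qed.

Lemma wf_subst P S k : wf P -> wf S -> wf (subst k S P).
Proof.
elim: P S k => //= [n|P IHP Q IHQ|P IHP Q IHQ|P IH] S k wfP wfS.
- by case: eqP.
- by case/andP: wfP => wfP wfQ; rewrite IHP ?IHQ.
- by case/andP: wfP => wfP wfQ; rewrite IHP ?IHQ.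
- case/andP: wfP => gP wfP.
  (* The bound index 0 does not occur in [shift 0 S], so it stays guarded. *)
  by rewrite IH ?wf_shift // guarded_subst ?guarded_shift_same.
Qed.

Lemma closed_at_shift P j k : closed_at k P -> closed_at k.+1 (shift j P).
Proof.
elim: P j k => //= [n|P IHP Q IHQ|P IHP Q IHQ|P IH] j k.
- by case: ifP; lia.
- by case/andP=> /IHP-> /IHQ->.
- by case/andP=> /IHP-> /IHQ->.
- exact: IH.
Qed.

Lemma closed_at_subst P S j k :
  j <= k -> closed_at k.+1 P -> closed_at k S -> closed_at k (subst j S P).
Proof.
elim: P S j k => //= [n|P IHP Q IHQ|P IHP Q IHQ|P IH] S j k le_jk clP clS.
- by case: eqP => //= neq_nj; case: ifP; lia.
- by case/andP: clP => clP clQ; rewrite IHP ?IHQ.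
- by case/andP: clP => clP clQ; rewrite IHP ?IHQ.
- by apply: IH; rewrite ?closed_at_shift.
Qed.

(** * Processes are preserved by transitions *)

Lemma step_wf P α P' : step P α P' -> wf P -> wf P'.
Proof.
elim=> {P α P'} //=.
- by move=> α P P' _ IH /[dup] wfMu /andP[_ /IH wfP']; apply: wf_subst.
- by move=> α P P' Q _ IH /andP[/IH].
- by move=> α P P' Q _ IH /andP[_ /IH].
- by move=> α P P' Q _ IH /andP[/IH-> ->].
- by move=> α P P' Q _ IH /andP[-> /IH->].
- by move=> a P P' Q Q' _ IHP _ IHQ /andP[/IHP-> /IHQ->].
Qed.

Lemma step_closed_at P α P' k : step P α P' -> closed_at k P -> closed_at k P'.
Proof.
move=> st; elim: st k => {P α P'} //=.
- by move=> α P P' _ IH k clP; apply: closed_at_subst => //; apply: IH.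
- by move=> α P P' Q _ IH k /andP[/IH].
- by move=> α P P' Q _ IH k /andP[_ /IH].
- by move=> α P P' Q _ IH k /andP[/IH-> ->].
- by move=> α P P' Q _ IH k /andP[-> /IH->].
- by move=> a P P' Q Q' _ IHP _ IHQ k /andP[/IHP-> /IHQ->].
Qed.

Lemma step_process P α P' : step P α P' -> process P -> process P'.
Proof.
by move=> st /andP[wfP clP]; rewrite /process (step_wf st) ?(step_closed_at st).
Qed.

Lemma tick_wf i P P' : tick i P P' -> wf P -> wf P'.
Proof.
elim=> {P P'} //=.
- by move=> P P' _ IH /[dup] wfMu /andP[_ /IH wfP']; apply: wf_subst.
- by move=> P P' Q Q' _ IHP _ IHQ /andP[/IHP-> /IHQ->].
- by move=> P P' Q Q' _ IHP _ IHQ _ /andP[/IHP-> /IHQ->].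
Qed.

Lemma tick_closed_at i P P' k : tick i P P' -> closed_at k P -> closed_at k P'.
Proof.
move=> tk; elim: tk k => {P P'} //=.
- by move=> P P' _ IH k clP; apply: closed_at_subst => //; apply: IH.
- by move=> P P' Q Q' _ IHP _ IHQ k /andP[/IHP-> /IHQ->].
- by move=> P P' Q Q' _ IHP _ IHQ _ k /andP[/IHP-> /IHQ->].
Qed.

Lemma tick_process i P P' : tick i P P' -> process P -> process P'.
Proof.
by move=> tk /andP[wfP clP]; rewrite /process (tick_wf tk) ?(tick_closed_at tk).
Qed.

Lemma tick_V1_V2 P P' : tick V1 P P' -> tick V2 P P'.
Proof. by elim=> {P P'} *; try done; constructor. Qed.

(** * Urgent sets and transitions under substitution *)

Lemma urgent_subst P S k α : urgent P α -> urgent (subst k S P) α.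
Proof.
elim: P S k α => //= [P IHP Q IHQ|P IHP Q IHQ|P IH L|P IH f|P IH] S k α.
- by case=> [uP|uQ]; [left; apply: IHP|right; apply: IHQ].
- case=> [uP|uQ|[-> [a uP uQ]]];
    [apply/Or31/IHP|apply/Or32/IHQ|apply: Or33] => //.
  by split=> //; exists a; [apply: IHP|apply: IHQ].
- by case=> uP ?; split=> //; apply: IH.
- by case=> β uP ->; exists β => //; apply: IH.
- exact: IH.
Qed.

Lemma step_subst P S k α P' :
  step P α P' -> step (subst k S P) α (subst k S P').
Proof.
move=> st; elim: st S k => {P α P'} /=; try by move=> *; econstructor; eauto.
move=> α P P' _ IH S k.
by rewrite subst_subst //=; apply: step_mu.
Qed.

(** A guarded [k] occurs only below action prefixes, where no premise of a step derivation reaches,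
    so [S] contributes no transition of its own. *)
Lemma step_subst_inv P S k α T :
  guarded k P -> step (subst k S P) α T ->
  exists2 P', step P α P' & T = subst k S P'.
Proof.
elim: P S k α T => /= [|n|β P IH|P IH|P IHP Q IHQ|P IHP Q IHQ|P IH L|P IH f|P IH] S k α T.
- by move=> _ st; inversion st.
- by move=> /negPf-> st; inversion st.
- by move=> _ st; inversion st; subst; exists P => //; constructor.
- move=> gP st; inversion st; subst.
  by have [P1 ? ->] := IH _ _ _ _ gP hyp; exists P1 => //; constructor.
- case/andP=> gP gQ st; inversion st; subst.
  + by have [P1 ? ->] := IHP _ _ _ _ gP hyp; exists P1 => //; constructor.
  + by have [P1 ? ->] := IHQ _ _ _ _ gQ hyp; exists P1 => //; constructor.
- case/andP=> gP gQ st; inversion st; subst.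
  + by have [P1 ? ->] := IHP _ _ _ _ gP hyp; exists (Par P1 Q) => //; constructor.
  + by have [P1 ? ->] := IHQ _ _ _ _ gQ hyp; exists (Par P P1) => //; constructor.
  + have [P1 ? ->] := IHP _ _ _ _ gP hyp; have [Q1 ? ->] := IHQ _ _ _ _ gQ hyp.
    by exists (Par P1 Q1) => //; econstructor; eauto.
- move=> gP st; inversion st; subst.
  by have [P1 ? ->] := IH _ _ _ _ gP hyp; exists (Res P1 L) => //; constructor.
- move=> gP st; inversion st; subst.
  by have [P1 ? ->] := IH _ _ _ _ gP hyp; exists (Rel P1 f) => //; constructor.
- move=> gP st; inversion st; subst.
  have [P1 ? ->] := IH _ _ _ _ gP hyp.
  by exists (subst 0 (Mu P) P1); [constructor | rewrite [RHS]subst_subst].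
Qed.

(** As for actions: a clock derivation never looks below an action prefix. *)
Lemma tick_subst_inv i P S k T :
  guarded k P -> tick i (subst k S P) T ->
  exists2 P', tick i P P' & T = subst k S P'.
Proof.
elim: P S k T => /= [|n|β P IH|P IH|P IHP Q IHQ|P IHP Q IHQ|P IH L|P IH f|P IH] S k T.
- by move=> _ tk; inversion tk; exists Defs.Nil => //; constructor.
- by move=> /negPf-> tk; inversion tk.
- by move=> _ tk; inversion tk; subst; exists (Act (Some a) P) => //; constructor.
- move=> gP tk; inversion tk; subst; first by exists P => //; constructor.
  by have [P1 ? ->] := IH _ _ _ gP hyp; exists P1 => //; apply: tick_clock2.
- case/andP=> gP gQ tk; inversion tk; subst.
  have [P1 ? ->] := IHP _ _ _ gP hyp; have [Q1 ? ->] := IHQ _ _ _ gQ hyp.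
  by exists (Sum P1 Q1) => //; constructor.
- case/andP=> gP gQ tk; inversion tk; subst.
  have [P1 ? ->] := IHP _ _ _ gP hyp; have [Q1 ? ->] := IHQ _ _ _ gQ hyp.
  exists (Par P1 Q1) => //; constructor=> //.
  (* An urgent τ of [Par P Q] would survive the substitution and block the given clock step. *)
  by move=> /(@urgent_subst (Par P Q) S k).
- move=> gP tk; inversion tk; subst.
  by have [P1 ? ->] := IH _ _ _ gP hyp; exists (Res P1 L) => //; constructor.
- move=> gP tk; inversion tk; subst.
  by have [P1 ? ->] := IH _ _ _ gP hyp; exists (Rel P1 f) => //; constructor.
- move=> gP tk; inversion tk; subst.
  have [P1 ? ->] := IH _ _ _ gP hyp.
  by exists (subst 0 (Mu P) P1); [constructor | rewrite [RHS]subst_subst].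
Qed.

(** * The relation of dropping clock prefixes *)

(** The left side of [faster_mu] has the shape of the target of a clock step of [Mu P], which is how
    unfolding enters. Transitivity is built in to allow several prefixes to be dropped. *)
Inductive faster : term Λ -> term Λ -> Prop :=
| faster_refl P : faster P P
| faster_trans P M Q : faster P M -> faster M Q -> faster P Q
| faster_clock P : faster P (Clock P)
| faster_sum P P' Q Q' : faster P P' -> faster Q Q' ->
    faster (Sum P Q) (Sum P' Q')
| faster_par P P' Q Q' : faster P P' -> faster Q Q' ->
    faster (Par P Q) (Par P' Q')
| faster_res P P' L : faster P P' -> faster (Res P L) (Res P' L)
| faster_rel P P' f : faster P P' -> faster (Rel P f) (Rel P' f)
| faster_mu P P' : faster P' P -> faster (subst 0 (Mu P) P') (Mu P).

Lemma faster_guarded P Q k : faster P Q -> guarded k Q -> guarded k P.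
Proof.
move=> PQ; elim: PQ k => {P Q} //=.
- by move=> P M Q _ IHP _ IHQ k /IHQ/IHP.
- by move=> P P' Q Q' _ IHP _ IHQ k /andP[/IHP-> /IHQ->].
- by move=> P P' Q Q' _ IHP _ IHQ k /andP[/IHP-> /IHQ->].
- by move=> P P' _ IH k gP; apply: guarded_subst => //; apply: IH.
Qed.

Lemma faster_wf P Q : faster P Q -> wf Q -> wf P.
Proof.
elim=> {P Q} //=.
- by move=> P M Q _ IHP _ IHQ /IHQ/IHP.
- by move=> P P' Q Q' _ IHP _ IHQ /andP[/IHP-> /IHQ->].
- by move=> P P' Q Q' _ IHP _ IHQ /andP[/IHP-> /IHQ->].
- by move=> P P' _ IH /[dup] wfMu /andP[_ /IH wfP']; apply: wf_subst.
Qed.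

Lemma faster_subst P Q S k : faster P Q -> faster (subst k S P) (subst k S Q).
Proof.
move=> PQ; elim: PQ S k => {P Q} /=; try by move=> *; constructor; auto.
- by move=> P M Q _ IHP _ IHQ S k; apply: faster_trans (IHP S k) (IHQ S k).
- by move=> P P' _ IH S k; rewrite subst_subst //=; apply: faster_mu.
Qed.

(** A clock-prefixed term has no urgent action, so dropping the prefix, like unfolding, can only add
    some. *)
Lemma faster_urgent P Q α : faster P Q -> urgent Q α -> urgent P α.
Proof.
move=> PQ; elim: PQ α => {P Q} //=.
- by move=> P M Q _ IHP _ IHQ α /IHQ/IHP.
- by move=> P P' Q Q' _ IHP _ IHQ α [/IHP|/IHQ]; [left|right].
- move=> P P' Q Q' _ IHP _ IHQ α [/IHP|/IHQ|[-> [a uP uQ]]];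
    [exact: Or31|exact: Or32|apply: Or33].
  by split=> //; exists a; [apply: IHP|apply: IHQ].
- by move=> P P' L _ IH α [uP ?]; split=> //; apply: IH.
- by move=> P P' f _ IH α [β uP ->]; exists β => //; apply: IH.
- by move=> P P' _ IH α uP; apply: urgent_subst; apply: IH.
Qed.

(** * Simulation properties of [faster] *)

(** Well-formedness serves the recursion case: guardedness passes from the body to its faster
    version, so a step of the unfolded term is a step of that version before substitution. *)
Lemma faster_step P Q α P' : wf Q -> faster P Q -> step P α P' ->
  exists2 Q', step Q α Q' & faster P' Q'.
Proof.
move=> wfQ PQ; elim: PQ α P' wfQ => {P Q} /=.
- by move=> P α P' _ st; exists P' => //; constructor.
- move=> P M Q _ IHP MQ IHQ α P' wfQ st.
  have [M' stM PM] := IHP _ _ (faster_wf MQ wfQ) st.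
  have [Q' stQ MQ'] := IHQ _ _ wfQ stM.
  by exists Q' => //; apply: faster_trans PM MQ'.
- by move=> P α P' _ st; exists P'; constructor.
- move=> P Q P2 Q2 _ IHP _ IHQ α T /andP[wfQ wfQ2] st; inversion st; subst.
  + by have [Q1 ? ?] := IHP _ _ wfQ hyp; exists Q1 => //; constructor.
  + by have [Q1 ? ?] := IHQ _ _ wfQ2 hyp; exists Q1 => //; constructor.
- move=> P Q P2 Q2 PQ IHP PQ2 IHQ α T /andP[wfQ wfQ2] st; inversion st; subst.
  + by have [Q1 ? ?] := IHP _ _ wfQ hyp; exists (Par Q1 Q2); constructor.
  + by have [Q1 ? ?] := IHQ _ _ wfQ2 hyp; exists (Par Q Q1); constructor.
  + have [Q1 ? ?] := IHP _ _ wfQ hyp; have [Q3 ? ?] := IHQ _ _ wfQ2 hyp.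
    by exists (Par Q1 Q3); econstructor; eauto.
- move=> P Q L _ IH α T wfQ st; inversion st; subst.
  by have [Q1 ? ?] := IH _ _ wfQ hyp; exists (Res Q1 L); constructor.
- move=> P Q f _ IH α T wfQ st; inversion st; subst.
  by have [Q1 ? ?] := IH _ _ wfQ hyp; exists (Rel Q1 f); constructor.
- move=> Q P PQ IH α T /andP[gQ wfQ] st.
  have [P' stP ->] := step_subst_inv (faster_guarded PQ gQ) st.
  have [Q' stQ PQ'] := IH _ _ wfQ stP.
  by exists (subst 0 (Mu Q) Q'); [constructor | apply: faster_subst].
Qed.

Lemma faster_step_inv P Q α Q' : faster P Q -> step Q α Q' ->
  exists2 P', step P α P' & faster P' Q'.
Proof.
move=> PQ; elim: PQ α Q' => {P Q} /=.
- by move=> P α P' st; exists P' => //; constructor.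
- move=> P M Q _ IHP _ IHQ α Q' /IHQ[M' /IHP[P' stP PM] MQ].
  by exists P' => //; apply: faster_trans PM MQ.
- by move=> P α P' st; inversion st; subst; exists P' => //; constructor.
- move=> P Q P2 Q2 _ IHP _ IHQ α T st; inversion st; subst.
  + by have [P1 ? ?] := IHP _ _ hyp; exists P1 => //; constructor.
  + by have [P1 ? ?] := IHQ _ _ hyp; exists P1 => //; constructor.
- move=> P Q P2 Q2 PQ IHP PQ2 IHQ α T st; inversion st; subst.
  + by have [P1 ? ?] := IHP _ _ hyp; exists (Par P1 P2); constructor.
  + by have [P1 ? ?] := IHQ _ _ hyp; exists (Par P P1); constructor.
  + have [P1 ? ?] := IHP _ _ hyp; have [P3 ? ?] := IHQ _ _ hyp.
    by exists (Par P1 P3); econstructor; eauto.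
- move=> P Q L _ IH α T st; inversion st; subst.
  by have [P1 ? ?] := IH _ _ hyp; exists (Res P1 L); constructor.
- move=> P Q f _ IH α T st; inversion st; subst.
  by have [P1 ? ?] := IH _ _ hyp; exists (Rel P1 f); constructor.
- move=> Q P _ IH α T st; inversion st; subst.
  have [P1 stP PQ1] := IH _ _ hyp.
  by exists (subst 0 (Mu Q) P1); [apply: step_subst | apply: faster_subst].
Qed.

(** Each clock rule is mirrored by a constructor of [faster]; [tick_clock2] is [faster_clock] after
    transitivity. *)
Lemma tick_faster i P P' : tick i P P' -> faster P' P.
Proof.
elim=> {P P'} *; try by constructor.
by apply: faster_trans; [eassumption | constructor].
Qed.

Lemma faster_tick i P Q P' : wf Q -> faster P Q -> tick i P P' ->
  exists2 Q', tick i Q Q' & faster P' Q'.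
Proof.
move=> wfQ PQ; elim: PQ P' wfQ => {P Q} /=.
- by move=> P P' _ tk; exists P' => //; constructor.
- move=> P M Q _ IHP MQ IHQ P' wfQ tk.
  have [M' tkM PM] := IHP _ (faster_wf MQ wfQ) tk.
  have [Q' tkQ MQ'] := IHQ _ wfQ tkM.
  by exists Q' => //; apply: faster_trans PM MQ'.
(* [Clock P] answers any clock step of [P] by merely losing its prefix, since the target [P'] is
   faster than [P]. *)
- by move=> P P' _ tk; exists P; [constructor | apply: tick_faster tk].
- move=> P Q P2 Q2 _ IHP _ IHQ T /andP[wfQ wfQ2] tk; inversion tk; subst.
  have [Q1 ? ?] := IHP _ wfQ hyp; have [Q3 ? ?] := IHQ _ wfQ2 hyp.
  by exists (Sum Q1 Q3); constructor.
- move=> P Q P2 Q2 PQ IHP PQ2 IHQ T /andP[wfQ wfQ2] tk; inversion tk; subst.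
  have [Q1 ? ?] := IHP _ wfQ hyp; have [Q3 ? ?] := IHQ _ wfQ2 hyp.
  (* An urgent τ of the slower composition would be urgent in the faster one, which does let time
     pass. *)
  exists (Par Q1 Q3); constructor=> //.
  by move=> /(faster_urgent (faster_par PQ PQ2)).
- move=> P Q L _ IH T wfQ tk; inversion tk; subst.
  by have [Q1 ? ?] := IH _ wfQ hyp; exists (Res Q1 L); constructor.
- move=> P Q f _ IH T wfQ tk; inversion tk; subst.
  by have [Q1 ? ?] := IH _ wfQ hyp; exists (Rel Q1 f); constructor.
- move=> Q P PQ IH T /andP[gQ wfQ] tk.
  have [P' tkP ->] := tick_subst_inv (faster_guarded PQ gQ) tk.
  have [Q' tkQ PQ'] := IH _ wfQ tkP.
  by exists (subst 0 (Mu Q) Q'); [constructor | apply: faster_subst].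
Qed.

(** * Passing between the two clock semantics *)

(** The derivation is replayed with each [tick_clock2] replaced by [tick_clock], which strips one
    prefix and stops. *)
Lemma tick_V2_V1 P P' : tick V2 P P' -> exists2 P1, tick V1 P P1 & faster P' P1.
Proof.
elim=> {P P'}.
- by exists Defs.Nil; constructor.
- by move=> a P; exists (Act (Some a) P); constructor.
- by move=> P; exists P; constructor.
- move=> P P' _ [P1 ? ?]; exists (subst 0 (Mu P) P1); first by constructor.
  exact: faster_subst.
- by move=> P P' L _ [P1 ? ?]; exists (Res P1 L); constructor.
- by move=> P P' f _ [P1 ? ?]; exists (Rel P1 f); constructor.
- by move=> P P' Q Q' _ [P1 ? ?] _ [Q1 ? ?]; exists (Sum P1 Q1); constructor.
- by move=> P P' Q Q' _ [P1 ? ?] _ [Q1 ? ?] ?; exists (Par P1 Q1); constructor.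
- by move=> P P' _ tk _; exists P; [constructor | apply: tick_faster tk].
Qed.

Lemma naive_preorder_V1_V2 P Q : naive_preorder V1 P Q -> naive_preorder V2 P Q.
Proof.
case=> R [procR simR] RPQ.
exists (fun P Q => process P /\ exists2 M, faster P M & R M Q); last first.
  have [prP _] := procR _ _ RPQ; split=> //.
  by exists P => //; apply: faster_refl.
split=> [{RPQ}P {}Q [prP [M _ /procR[]]] // | {RPQ}P {}Q [prP [M PM RMQ]]].
have [/andP[wfM _] _] := procR _ _ RMQ.
have [simL simR' simT] := simR _ _ RMQ; split.
- move=> α P' stP; have [M' stM PM'] := faster_step wfM PM stP.
  have [Q' stQ RMQ'] := simL _ _ stM.
  by exists Q' => //; split; [apply: step_process stP prP | exists M'].
- move=> α Q' /simR'[M' stM RMQ'].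
  have [P' stP PM'] := faster_step_inv PM stM.
  by exists P' => //; split; [apply: step_process stP prP | exists M'].
(* The intermediate [M] answers in the second semantics. Its step is cut back to a step of the
   first, to the slower [M1], which [R] can match; the answer of [Q] is then also a step of the
   second. *)
- move=> P' tkP; have [M' tkM PM'] := faster_tick wfM PM tkP.
  have [M1 /simT[Q1 tkQ RMQ1] MM1] := tick_V2_V1 tkM.
  exists Q1; first exact: tick_V1_V2.
  split; first exact: tick_process tkP prP.
  by exists M1 => //; apply: faster_trans PM' MM1.
Qed.

Lemma naive_preorder_V2_V1 P Q : naive_preorder V2 P Q -> naive_preorder V1 P Q.
Proof.
case=> R [procR simR] RPQ.
exists (fun P Q => process Q /\ exists2 M, R P M & faster M Q); last first.
  have [_ prQ] := procR _ _ RPQ; split=> //.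
  by exists Q => //; apply: faster_refl.
split=> [{RPQ}P {}Q [prQ [M /procR[]]] // | {RPQ}P {}Q [prQ [M RPM MQ]]].
have wfQ : wf Q by case/andP: prQ.
have [simL simR' simT] := simR _ _ RPM; split.
- move=> α P' /simL[M' stM RPM'].
  have [Q' stQ MQ'] := faster_step wfQ MQ stM.
  by exists Q' => //; split; [apply: step_process stQ prQ | exists M'].
- move=> α Q' stQ; have [M' stM MQ'] := faster_step_inv MQ stQ.
  have [P' stP RPM'] := simR' _ _ stM.
  by exists P' => //; split; [apply: step_process stQ prQ | exists M'].
(* Here the cut comes last: [Q] first answers in the second semantics, and its step is then
   shortened, which only makes the target slower. *)
- move=> P' /tick_V1_V2/simT[M' tkM RPM'].
  have [Q' tkQ MQ'] := faster_tick wfQ MQ tkM.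
  have [Q1 tkQ1 QQ1] := tick_V2_V1 tkQ.
  exists Q1 => //; split; first exact: tick_process tkQ1 prQ.
  by exists M' => //; apply: faster_trans MQ' QQ1.
Qed.

End Terms.

Theorem theorem10 (Λ : countType) (P Q : term Λ)
  (hP : process P) (hQ : process Q) :
  naive_preorder V1 P Q <-> naive_preorder V2 P Q.
Proof. by split; [apply: naive_preorder_V1_V2 | apply: naive_preorder_V2_V1]. Qed.
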